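(* Let $f:\mathcal{A}\rightarrow\mathcal{A}$ be a map such that $$f(A+BP)\equiv f(A) \pmod P\quad\text{for every } A,B\in\mathcal{A} \text{ and every } P\in\mathcal{P},$$ and $$\deg(f(A))< \frac{q^{\deg(A)}}{27q\deg(A)}\quad\text{whenever } A\in\mathcal{A} \text{ and } \deg(A) \text{ is sufficiently large}.$$ Then $f$ is a polynomial map.
   Context: $\mathbb{F}$ is the finite field of order $q$ and characteristic $p$, $\mathcal{A}=\mathbb{F}[t]$, and $\mathcal{K}=\mathbb{F}(t)$. $\deg$ is the usual degree on $\mathcal{A}$, with $\deg(0)=-\infty$. $\mathcal{P}\subset\mathcal{A}$ is the set of irreducible polynomials. A map $f:\mathcal{A}\to\mathcal{A}$ is called a polynomial map if it is given by the values on $\mathcal{A}$ of an element of $\mathcal{K}[X]$, i.e. there is $F(X)\in\mathcal{K}[X]$ with $f(A)=F(A)$ for every $A\in\mathcal{A}$. *)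

(* Defs.v *)
From HB Require Import structures.
From mathcomp Require Import all_boot all_order all_algebra.
From mathcomp Require Import constructive_ereal.

Set Implicit Arguments.
Unset Strict Implicit.
Unset Printing Implicit Defensive.

Import Order.TTheory GRing.Theory Num.Theory.
Local Open Scope ring_scope.

Definition deg (F : fieldType) (A : {poly F}) : \bar rat :=
  if A == 0 then -oo%E else ((size A).-1%:R)%:E.

Definition polynomial_map (F : fieldType) (f : {poly F} -> {poly F}) : Prop :=
  exists G : {poly {fraction {poly F}}},
    forall A : {poly F}, tofrac (f A) = G.[tofrac A].

(* Main.v *)
Require Import Defs.
From HB Require Import structures.
From mathcomp Require Import all_boot all_order all_algebra.
From mathcomp Require Import constructive_ereal.
From mathcomp Require Import separable finfield qfpoly.
From mathcomp Require Import zify ring.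

Set Implicit Arguments.
Unset Strict Implicit.
Unset Printing Implicit Defensive.

Import Order.TTheory GRing.Theory Num.Theory.
Import Pdiv.CommonRing Pdiv.Idomain Pdiv.Field.
Local Open Scope ring_scope.

(** Write q for the cardinal of F, and deg A for the degree in the variable t
    of F[t]. The proof is Thue's method over F[t].

    A congruence modulo all the irreducible factors of a squarefree polynomial
    is a congruence modulo that polynomial [congr_mod_separable]. The main
    modulus is t^(q^m) - t: it is squarefree of degree q^m, exponential in m,
    while its irreducible factors have degree at most m [dvd_irreducible_size].

    Algebraicity. Consider the Q(X, Y) over F[t] with about q^n/3 coefficients
    in t, q^n/(3n) powers of X and 9qn powers of Y. The bound on deg f makes
    Q(A, f(A)) of degree less than q^m for every A of degree m >= n, and less
    than q^n for the q^n polynomials A of degree less than n. Vanishing at the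
    latter is a linear system of q^(2n) equations over F in more than
    q * q^(2n) unknowns; this is where the constant 27 = 3 * 3 * 3 comes from.
    Hence some Q != 0 vanishes there [auxiliary_polynomial]. If A has degree
    m >= n, it is congruent to polynomials of smaller degree modulo all the
    irreducible factors of t^(q^m) - t, so by induction t^(q^m) - t divides
    Q(A, f(A)), whose degree is too small: Q(A, f(A)) = 0 for every A
    [root_of_auxiliary].

    Linear growth. Being a root of Q(A, Y), the value f(A) has degree
    O(deg A) [linear_growth].

    Polynomiality. Say deg f(A) <= C deg A + O(1). Let P interpolate M f, with
    M a nonzero element of F[t], at the C + 1 nodes t + t^(q i), and put
    g = M f - P. The differences of A = t^(q^m) and a node have derivative -1,
    hence are squarefree, and all divide g(A), as g vanishes at the nodes. Their
    pairwise gcds have bounded degree, so up to a bounded factor their product,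
    of degree (C + 1) q^m, divides g(A), of degree at most C q^m + O(1). So g(t^(q^m)) = 0 for
    all large m [zero_on_Xn]. These zeros propagate to every B through the
    congruences [zero_of_zero_on_Xn], and f = P / M. *)

(** * Congruences modulo squarefree polynomials *)

Lemma irreducible_dvd_exists (F : finFieldType) (p : {poly F}) :
  (1 < size p)%N -> exists2 P, irreducible_poly P & P %| p.
Proof.
move=> sp.
pose has_divisor n :=
  (1 < n)%N && [exists d : {poly_n F}, (size d == n) && ((d : {poly F}) %| p)].
have ex_n : exists n, has_divisor n.
  exists (size p); rewrite /has_divisor sp; apply/existsP.
  by exists (npolyp _ p); rewrite npolypK // eqxx dvdpp.
case: (ex_minnP ex_n) => n /andP[n_gt1 /existsP[d /andP[/eqP sd d_p]]] n_min.
exists d => //; split=> [|u su u_d]; first by rewrite sd.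
have d0 : (d : {poly F}) != 0 by rewrite -size_poly_gt0 sd ltnW.
have u0 : u != 0 by apply: contraNneq d0 => u0; rewrite -dvd0p -u0.
rewrite -dvdp_size_eqp // eqn_leq dvdp_leq //= sd n_min // /has_divisor.
rewrite ltn_neqAle eq_sym su size_poly_gt0 u0; apply/existsP.
by exists (npolyp _ u); rewrite npolypK // eqxx (dvdp_trans u_d).
Qed.

(** A separable polynomial is a product of pairwise coprime irreducible
    factors; splitting them off one at a time gives the divisibility. *)
Lemma separable_dvd (F : finFieldType) (S R : {poly F}) :
    separable_poly S ->
    (forall P, irreducible_poly P -> P %| S -> P %| R) ->
  S %| R.
Proof.
have [n] := ubnP (size S); elim: n S => // n IHn S /ltnSE-sS sepS irrS.
have S0 : S != 0.
  apply: contraTneq sepS => ->.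
  by rewrite unlock coprime0p deriv0 -size_poly_eq1 size_poly0.
have [sS1|sS1] := leqP (size S) 1.
  by apply/(dvdp_trans _ (dvd1p R)); rewrite dvdp1 eqn_leq sS1 size_poly_gt0.
have [P irrP P_S] := irreducible_dvd_exists sS1.
have [T defS] := dvdpP _ _ P_S.
have T0 : T != 0 by apply: contraNneq S0 => T0; rewrite defS T0 mul0r.
have P0 := irredp_neq0 irrP.
move: sepS; rewrite defS separable_mul => /and3P[sepT _ coTP].
rewrite Gauss_dvdp // (irrS P) // andbT IHn // => [|Q irrQ Q_T]; last first.
  by apply: irrS => //; rewrite defS dvdp_mulr.
apply: leq_trans sS; rewrite defS size_mul //.
by case: irrP; case: (size P) => [|[|k]] //= _ _; rewrite !addnS /= ltnS leq_addr.
Qed.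

(** The congruence hypothesis on f, in the form that composes with polynomial maps. *)
Definition congr_mod_primes (F : fieldType) (f : {poly F} -> {poly F}) :=
  forall A B P : {poly F}, irreducible_poly P -> P %| A - B -> P %| f A - f B.

Lemma congr_mod_separable (F : finFieldType) (f : {poly F} -> {poly F})
    (A B S : {poly F}) :
  congr_mod_primes f -> separable_poly S -> S %| A - B -> S %| f A - f B.
Proof.
move=> cong_f sepS S_AB; apply: separable_dvd => // P irrP P_S.
exact/cong_f/(dvdp_trans P_S).
Qed.

Lemma dvd_horner_sub (R : comNzRingType) (p : {poly R}) (x y : R) :
  exists k, p.[x] - p.[y] = (x - y) * k.
Proof.
have /factor_theorem[k defp] : root (p - p.[y]%:P) y.
  by rewrite /root !hornerE subrr.
exists k.[x]; rewrite mulrC -[x - y](hornerXsubC y) -hornerM -defp.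
by rewrite !hornerE.
Qed.

Lemma congr_horner2 (F : fieldType) (f : {poly F} -> {poly F})
    (Q : {poly {poly {poly F}}}) :
  congr_mod_primes f -> congr_mod_primes (fun A => Q.[(f A)%:P].[A]).
Proof.
move=> cong_f A B P irrP P_AB.
have [K defK] := dvd_horner_sub Q (f A)%:P (f B)%:P.
have [L defL] := dvd_horner_sub Q.[(f B)%:P] A B.
rewrite -(subrKA Q.[(f B)%:P].[A]) -hornerN -hornerD defK defL.
by rewrite -polyCB hornerM hornerC dvdp_add // dvdp_mulr // cong_f.
Qed.

(** * The polynomials X^(q^m) - B *)

Section FrobeniusPolynomial.
Variable F : finFieldType.
Local Notation q := #|F|.

Lemma card_pchar_nat (R : nzRingType) m :
  (forall p, p \in [pchar F] -> p \in [pchar R]) -> [pchar R].-nat (q ^ m)%N.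
Proof.
move=> sub_char; have [p p_pr charFp] := finPcharP F.
have -> : q = (p ^ logn p q)%N := card_pprimeChar charFp.
rewrite -expnM pnatX; apply/orP; left.
by rewrite pnatE // sub_char.
Qed.

Lemma expf_card_exp m (c : F) : c ^+ (q ^ m) = c.
Proof. by elim: m => [|m IHm]; rewrite ?expr1 // expnS exprM expf_card. Qed.

(** Modulo 'X^(q ^ m) - 'X the Frobenius power q ^ m fixes the constants and
    the variable, and it is additive and multiplicative. *)
Lemma dvdp_exp_card_sub m (A : {poly F}) :
  'X^(q ^ m) - 'X %| A ^+ (q ^ m) - A.
Proof.
elim/poly_ind: A => [|A c IHA].
  by rewrite expr0n expn_eq0 -leqn0 leqNgt (ltnW (finNzRing_gt1 F)) subr0 dvdp0.
rewrite exprDn_pchar; last first.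
  by apply: card_pchar_nat => p; rewrite pchar_poly.
rewrite exprMn -polyC_exp expf_card_exp opprD addrACA subrr addr0.
rewrite -[A ^+ _ * _ - _](subrKA (A * 'X^(q ^ m))) -mulrBl -mulrBr.
by apply: dvdp_add; [apply: dvdp_mulr | apply: dvdp_mull].
Qed.

(** In the field F[X]/(P), which has q ^ deg P elements, every element is a root
    of 'X^(q ^ m) - 'X; so q ^ deg P <= q ^ m. *)
Lemma dvd_irreducible_size m (P : {poly F}) :
  (0 < m)%N -> irreducible_poly P -> P %| 'X^(q ^ m) - 'X -> (size P <= m.+1)%N.
Proof.
move=> m_gt0 irrP; set N := (q ^ m)%N.
have P0 := irredp_neq0 irrP; have lP0 : lead_coef P != 0 by rewrite lead_coef_eq0.
pose M := (lead_coef P)^-1 *: P.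
have eqPM : M %= P by rewrite eqp_scale // invr_eq0.
have irrM : monic_irreducible_poly M.
  split; last by rewrite monicE lead_coefZ mulVf.
  split=> [|Q sQ]; first by rewrite (eqp_size eqPM); case: irrP.
  by rewrite (eqp_dvdr _ eqPM) => /irrP.2-/(_ sQ) /eqp_trans -> //; rewrite eqp_sym.
rewrite -(eqp_dvdl _ eqPM) -(eqp_size eqPM) => M_dvd.
pose E := {poly %/ M with irrM}.
have N_gt1 : (1 < N)%N by rewrite -(exp1n m) ltn_exp2r // finNzRing_gt1.
have sXN : size ('X^N - 'X : {poly E}) = N.+1.
  by rewrite size_polyDl ?size_polyXn // size_polyN size_polyX ltnS.
have XN0 : 'X^N - 'X != 0 :> {poly E} by rewrite -size_poly_gt0 sXN.
have rootE : all (root ('X^N - 'X : {poly E})) (enum E).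
  apply/allP=> e _; rewrite /root !hornerE.
  (* Lift e to a polynomial w: the modulus M divides w ^+ N - w. *)
  have [w <-] : exists w, in_qpoly M w = e.
    by exists e; apply/val_inj/in_qpoly_small/size_mk_monic.
  rewrite -(rmorphXn (in_qpoly M)) -(rmorphB (in_qpoly M)); apply/eqP/val_inj => /=.
  rewrite (mk_monicE irrM); apply/eqP; rewrite -/(rdvdp _ _) -dvdpE.
  exact: dvdp_trans M_dvd (dvdp_exp_card_sub _ _).
have := max_poly_roots XN0 rootE (enum_uniq _).
rewrite -cardE card_qfpoly sXN ltnS leq_exp2l ?finNzRing_gt1 // -ltnS prednK //.
by rewrite ltnW // irrM.1.1.
Qed.

Lemma card_natr_eq0 : q%:R = 0 :> F.
Proof.
have [p p_pr charFp] := finPcharP F.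
have q_p : q = (p ^ logn p q)%N := card_pprimeChar charFp.
apply/eqP; rewrite -(dvdn_pcharf charFp) q_p; case: (logn p q) q_p => [|k _].
  by move=> q1; have := finNzRing_gt1 F; rewrite q1.
by rewrite expnS dvdn_mulr.
Qed.

Lemma deriv_exp_card m (A : {poly F}) : (0 < m)%N -> (A ^+ (q ^ m))^`() = 0.
Proof.
move=> m_gt0; rewrite deriv_exp -mulr_natr -polyC_natr natrX card_natr_eq0.
by rewrite expr0n eqn0Ngt m_gt0 polyC0 mulr0.
Qed.

(** The derivative of 'X^(q ^ m) - B is that of - B, here a nonzero constant. *)
Lemma separable_Xn_sub m (B : {poly F}) :
  (0 < m)%N -> size B^`() = 1%N -> separable_poly ('X^(q ^ m) - B).
Proof.
move=> m_gt0 /eqP; rewrite size_poly_eq1 => eqp_B1.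
rewrite unlock derivB deriv_exp_card // sub0r -[- B^`()]scaleN1r.
rewrite coprimepZr ?oppr_eq0 ?oner_eq0 //.
by rewrite (eqp_coprimepr _ eqp_B1) coprimep1.
Qed.
End FrobeniusPolynomial.

(** * The auxiliary polynomial *)

Lemma size_horner_leq (R : idomainType) (p : {poly {poly R}}) (x : {poly R}) (H I : nat) :
    (forall i, (size (p`_i)%R <= H)%N) -> (size p <= I.+1)%N ->
  (size (p.[x])%R <= H + (size x).-1 * I)%N.
Proof.
move=> sH sI; rewrite horner_coef; apply: (leq_trans (size_sum _ _ _)).
apply/bigmax_leqP => i _; apply: (leq_trans (size_polyMleq _ _)).
rewrite -subn1 leq_subLR add1n -addnS leq_add ?sH //.
apply: leq_trans (size_poly_exp_leq x i) _; rewrite ltnS leq_mul //.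
by rewrite -ltnS (leq_trans (ltn_ord i)).
Qed.

Lemma horner_map_eval (R : comNzRingType) (Q : {poly {poly R}}) (x y : R) :
  (map_poly (horner_eval x) Q).[y] = Q.[y%:P].[x].
Proof. by rewrite -[y in LHS](hornerC y x) (horner_map (horner_eval x)). Qed.

Lemma size_horner2_leq (R : idomainType) (Q : {poly {poly {poly R}}})
    (x y : {poly R}) (H I J : nat) :
    (forall j i, (size (Q`_j`_i)%R <= H)%N) -> (forall j, (size (Q`_j)%R <= I.+1)%N) ->
    (size Q <= J.+1)%N ->
  (size (Q.[y%:P].[x])%R <= H + (size x).-1 * I + (size y).-1 * J)%N.
Proof.
move=> sH sI sJ; rewrite -horner_map_eval; apply: size_horner_leq => [j|].
  by rewrite coef_map; apply: size_horner_leq.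
exact: leq_trans (size_poly _ _) sJ.
Qed.

(** Siegel's lemma for bivariate polynomials: Q has H * I.+1 * J.+1 free
    coefficients in F, and its vanishing at the #|T| points amounts to #|T| * B
    linear conditions. Over a finite field pigeonhole suffices: two distinct
    polynomials take the same values, and Q is their difference. *)
Lemma auxiliary_polynomial (F : finFieldType) (T : finType) (x y : T -> {poly F})
    (H I J B : nat) :
    (forall p, (H + (size (x p)).-1 * I + (size (y p)).-1 * J <= B)%N) ->
    (#|T| * B < H * (I.+1 * J.+1))%N ->
  exists Q : {poly {poly {poly F}}},
    [/\ Q != 0, (size Q <= J.+1)%N,
        forall j, (size (Q`_j)%R <= I.+1)%N,
        forall j i, (size (Q`_j`_i)%R <= H)%N
      & forall p, Q.[(y p)%:P].[x p] = 0].
Proof.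
move=> sB lt_card.
pose coefs := {ffun 'I_J.+1 * 'I_I.+1 -> {poly_H F}}.
pose Qof (c : coefs) : {poly {poly {poly F}}} :=
  \poly_(j < J.+1) \poly_(i < I.+1) (c (inord j, inord i) : {poly F}).
have sQ c : (size (Qof c) <= J.+1)%N by apply: size_poly.
have sQj c j : (size ((Qof c)`_j)%R <= I.+1)%N.
  by rewrite coef_poly; case: ifP => _; rewrite ?size_poly0 ?size_poly.
have sQji c j i : (size ((Qof c)`_j`_i)%R <= H)%N.
  rewrite coef_poly; case: ifP => _; last by rewrite coef0 size_poly0.
  by rewrite coef_poly; case: ifP => _; rewrite ?size_poly0.
pose values (c : coefs) : {ffun T -> {poly_B F}} :=
  [ffun p => npolyp B (Qof c).[(y p)%:P].[x p]].
have /injectivePn[c1 [c2 neq_c eq_v]] : ~~ injectiveb values.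
  apply/negP => /injectiveP/leq_card.
  rewrite !card_ffun !card_npoly card_prod !card_ord -!expnM.
  rewrite leq_exp2l ?finNzRing_gt1 // [(B * _)%N]mulnC [(J.+1 * _)%N]mulnC.
  by rewrite leqNgt lt_card.
have size_sub (R : nzRingType) (u v : {poly R}) k :
    (size u <= k)%N -> (size v <= k)%N -> (size (u - v)%R <= k)%N.
  by move=> su sv; rewrite (leq_trans (size_polyD _ _)) // size_polyN geq_max su.
exists (Qof c1 - Qof c2); split=> [|||j i|p].
- apply: contraNneq neq_c => Q0; apply/eqP/ffunP=> -[j i]; apply: val_inj => /=.
  have /eqP := congr1 (fun Q : {poly {poly {poly F}}} => Q`_j`_i) Q0.
  by rewrite !(coefB, coef0, coef_poly, ltn_ord) subr_eq0 !inord_val => /eqP.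
- exact: size_sub.
- by move=> j; rewrite coefB size_sub.
- by rewrite !coefB size_sub.
have sv c : (size ((Qof c).[(y p)%:P].[x p])%R <= B)%N.
  by apply: leq_trans (sB p); apply: size_horner2_leq.
have /(congr1 val) := congr1 (fun v : {ffun T -> {poly_B F}} => v p) eq_v.
by rewrite !ffunE !(hornerD, hornerN) /= !npolypK // => ->; rewrite subrr.
Qed.

Lemma leq_mul_exp q n m : (1 < q -> 0 < n -> n <= m -> m * q ^ n <= n * q ^ m)%N.
Proof.
move=> q_gt1 n_gt0 /subnK <-; elim: (m - n)%N => [|k]; first by rewrite add0n.
rewrite addSn expnS; have : (q ^ n <= q ^ (k + n))%N by rewrite leq_exp2l ?leq_addl.
nia.
Qed.

(** Strong induction on the degree m of A. Each irreducible factor P of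
    'X^(q ^ m) - 'X has degree at most m, so A %% P has degree less than m, where
    the claim is known; hence 'X^(q ^ m) - 'X divides the value at A, which is
    too small to be a nonzero multiple. *)
Lemma root_of_auxiliary (F : finFieldType) (f : {poly F} -> {poly F})
    (Q : {poly {poly {poly F}}}) n :
    congr_mod_primes f ->
    (forall A : {poly F}, (size A <= n)%N -> Q.[(f A)%:P].[A] = 0) ->
    (forall A : {poly F}, n < size A ->
       size (Q.[(f A)%:P].[A])%R <= #|F| ^ (size A).-1)%N ->
    (0 < n)%N ->
  forall A, Q.[(f A)%:P].[A] = 0.
Proof.
move=> cong_f Q0 sQ n_gt0 A; have [k] := ubnP (size A); elim: k A => // k IHk A.
move=> /ltnSE-sAk; have [/Q0//|n_lt] := leqP (size A) n.
have := sQ A n_lt; set m := (size A).-1; set R := Q.[_].[A] => sR.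
have m_gt0 : (0 < m)%N by rewrite /m -subn1 subn_gt0 (leq_ltn_trans n_gt0).
apply/eqP; apply: contraLR sR => R0; rewrite -ltnNge.
have sX : size ('X^(#|F| ^ m) - 'X : {poly F}) = (#|F| ^ m).+1.
  have : (1 < #|F| ^ m)%N by rewrite -(exp1n m) ltn_exp2r // finNzRing_gt1.
  by move=> N_gt1; rewrite size_polyDl ?size_polyXn // size_polyN size_polyX ltnS.
rewrite -sX dvdp_leq //; apply: separable_dvd => [|P irrP /(dvd_irreducible_size m_gt0)].
  by apply: separable_Xn_sub; rewrite // derivX size_poly1.
move=> /(_ irrP) sP; rewrite -[R]subr0 -(IHk (A %% P)); last first.
  apply: leq_trans sAk; rewrite (leq_trans (ltn_modpN0 _ (irredp_neq0 irrP))) //.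
  by rewrite (leq_trans sP) // prednK // (ltn_trans n_gt0).
apply: (congr_horner2 Q cong_f) => //.
by rewrite {1}(divp_eq A P) addrK dvdp_mull.
Qed.

(** The three contributions H, deg A * I and deg (f A) * J to the size of a value
    of Q are each at most about a third of q ^ m, while H * I.+1 * J.+1 exceeds the
    q ^ n * q ^ n conditions at the points of degree less than n. *)
Lemma algebraic_of_growth (F : finFieldType) (f : {poly F} -> {poly F}) n :
    congr_mod_primes f -> (0 < n)%N ->
    (forall A : {poly F}, let m := maxn n (size A).-1 in
       27 * #|F| * m * (size (f A)).-1 < #|F| ^ m)%N ->
  exists2 Q : {poly {poly {poly F}}}, Q != 0 & forall A, Q.[(f A)%:P].[A] = 0.
Proof.
move=> cong_f n_gt0 small_f; set q := #|F| in small_f *.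
have q_gt1 : (1 < q)%N := finNzRing_gt1 F.
pose H := (q ^ n %/ 3).+1; pose I := (q ^ n %/ (3 * n))%N.
pose J := (9 * q * n).-1.
have bound (A : {poly F}) (m := maxn n (size A).-1) :
  (H + (size A).-1 * I + (size (f A)).-1 * J <= q ^ m)%N.
  have n_m : (n <= m)%N by rewrite leq_maxl.
  have A_m : ((size A).-1 <= m)%N by rewrite leq_maxr.
  have := small_f A; rewrite /= -/m.
  have := leq_mul_exp q_gt1 n_gt0 n_m.
  have : (q ^ n <= q ^ m)%N by rewrite leq_exp2l.
  have hH : (3 * H <= q ^ n + 3)%N by rewrite /H; lia.
  have hI : (3 * n * I <= q ^ n)%N by rewrite mulnC leq_trunc_div.
  have hJ : (J <= 9 * q * n)%N by rewrite leq_pred.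
  move: (size (f A)).-1 (size A).-1 A_m => d a a_m.
  move: (q ^ n)%N (q ^ m)%N hH hI => u v hH hI uv nmuv dv.
  (* I is chosen for degree n; passing to degree m >= n uses u / n <= v / m. *)
  have h1 : (3 * (a * I) <= v)%N.
    rewrite -(leq_pmul2l n_gt0) (leq_trans _ nmuv) //.
    have : (m * (3 * n * I) <= m * u)%N by rewrite leq_mul.
    have : (a * (n * I) <= m * (n * I))%N by rewrite leq_mul.
    lia.
  have h2 : (3 * (d * J) < v)%N.
    apply: leq_ltn_trans dv.
    have : (d * J <= d * (9 * q * n))%N by rewrite leq_mul.
    have : (d * (9 * q * n) <= d * (9 * q * m))%N by rewrite !leq_mul.
    lia.
  lia.
have [||Q [Q0 sQ sQj sQji Qp]] := @auxiliary_polynomial F {poly_n F}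
    (fun A => A) (fun A => f A) H I J (q ^ n).
- move=> A /=; have := bound A; rewrite (maxn_idPl _) //.
  by rewrite (leq_trans (leq_pred _)).
- rewrite card_npoly -/q.
  have hH : (q ^ n < 3 * H)%N by rewrite /H; lia.
  have hI : (q ^ n < 3 * n * I.+1)%N by rewrite mulnC -ltn_divLR // muln_gt0.
  have hJ : (J.+1 = 9 * q * n)%N by rewrite /J prednK // !muln_gt0 n_gt0 (ltnW q_gt1).
  rewrite hJ; have := ltn_mul hH hI.
  have : (0 < q ^ n)%N by rewrite expn_gt0 (ltnW q_gt1).
  have : (1 * (H * (I.+1 * n)) <= q * (H * (I.+1 * n)))%N.
    by apply: leq_mul => //; apply: ltnW.
  lia.
exists Q => //; apply: (root_of_auxiliary cong_f (n := n)) => // A sA.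
  by have := Qp (npolyp n A); rewrite /= npolypK.
have sAn : (n <= (size A).-1)%N by lia.
by have := bound A; rewrite (maxn_idPr sAn); apply: leq_trans; apply: size_horner2_leq.
Qed.

(** * Algebraic functions grow linearly *)

Definition height (R : nzSemiRingType) (p : {poly {poly R}}) : nat :=
  \max_(i < size p) size (p`_i)%R.

Lemma leq_coef_bound (R : nzSemiRingType) (mu : R -> nat) (p : {poly R}) i :
  mu 0 = 0%N -> (mu (p`_i)%R <= \max_(j < size p) mu (p`_j)%R)%N.
Proof.
move=> mu0; have [le_p_i|lt_i_p] := leqP (size p) i.
  by rewrite nth_default ?mu0.
exact: (leq_bigmax (Ordinal lt_i_p)).
Qed.

Lemma size_coef_height (R : nzSemiRingType) (p : {poly {poly R}}) i :
  (size (p`_i)%R <= height p)%N.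
Proof.
apply: (leq_coef_bound (mu := fun c : {poly R} => size c)).
by rewrite size_poly0.
Qed.

(** If the size of x exceeded H, the term of highest degree of p at x would be
    larger than the sum of all the others. *)
Lemma size_root_leq (R : idomainType) (p : {poly {poly R}}) (x : {poly R}) (H : nat) :
    p != 0 -> root p x -> (forall i, (size (p`_i)%R <= H)%N) ->
  (size x <= H)%N.
Proof.
move=> p0 /eqP px0 sH; have := px0.
rewrite horner_coef -(ltn_predK (m := 0) (n := size p)) ?size_poly_gt0 //.
rewrite big_ord_recr /= => /eqP; rewrite addrC addr_eq0 => /eqP lead_eq.
have l0 : p`_(size p).-1 != 0 by rewrite -lead_coefE lead_coef_eq0.
have [->|x0] := eqVneq x 0; first by rewrite size_poly0.
have := congr1 (fun u : {poly R} => size u) lead_eq.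
rewrite size_polyN size_mul ?expf_neq0 //.
case: (size p).-1 l0 => [|k] l0.
  rewrite big_ord0 size_poly0 expr0 size_poly1 addn1 /= => /eqP.
  by rewrite size_poly_eq0 (negPf l0).
rewrite -(horner_poly _ (fun i => p`_i)).
have := @size_horner_leq R (\poly_(i < k.+1) p`_i) x H k.
move=> /(_ _ (size_poly _ _))-s_rest eq_size.
have {s_rest} : (size ((\poly_(i < k.+1) p`_i).[x])%R <= H + (size x).-1 * k)%N.
  by apply: s_rest => i; rewrite coef_poly; case: ifP; rewrite ?size_poly0.
rewrite -eq_size; have := size_exp x k.+1.
have : (0 < size (x ^+ k.+1))%N by rewrite size_poly_gt0 expf_neq0.
move: l0 x0.
rewrite -!size_poly_gt0 mulnS.
move: (size (p`_k.+1)%R) (size (x ^+ k.+1)) (size x) => a b c.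
move: (c.-1 * k)%N => d a_gt0 c_gt0 b_gt0 b_eq ab_le; lia.
Qed.

(** For A large, the leading coefficient of Q in Y does not vanish at A, by
    [size_root_leq]; then f A is a root of the nonzero polynomial Q(A, Y), whose
    coefficients have size linear in that of A. *)
Lemma linear_growth (R : idomainType) (f : {poly R} -> {poly R})
    (Q : {poly {poly {poly R}}}) :
    Q != 0 -> (forall A, Q.[(f A)%:P].[A] = 0) ->
  exists C D : nat, forall A : {poly R}, (D < size A -> size (f A) <= C * size A)%N.
Proof.
move=> Q0 Qf.
pose H := (\max_(j < size Q) height (Q`_j)%R)%N.
pose I := (\max_(j < size Q) size (Q`_j)%R)%N.
have height0 : height (0 : {poly {poly R}}) = 0%N by rewrite /height size_poly0 big_ord0.
have sQ j i : (size ((Q`_j)`_i)%R <= H)%N.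
  by apply: leq_trans (size_coef_height _ _) _; apply: leq_coef_bound.
have sI j : (size (Q`_j)%R <= I.+1)%N.
  apply/leqW/(leq_coef_bound (mu := fun c : {poly {poly R}} => size c)).
  by rewrite size_poly0.
exists (H + I)%N, (height (lead_coef Q)) => A ltA.
have lA0 : (lead_coef Q).[A] != 0.
  apply: contraTneq ltA => lA0; rewrite -leqNgt.
  apply: (size_root_leq (p := lead_coef Q)); rewrite ?lead_coef_eq0 //; first exact/eqP.
  exact: size_coef_height.
have rootA : root (map_poly (horner_eval A) Q) (f A).
  by rewrite /root horner_map_eval Qf.
have QA0 : map_poly (horner_eval A) Q != 0.
  apply: contraNneq lA0 => QA0.
  by rewrite lead_coefE -[_.[A]]/(horner_eval A _) -coef_map QA0 coef0.
apply: leq_trans (size_root_leq (H := (H + (size A).-1 * I)%N) QA0 rootA _) _.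
  by move=> j; rewrite coef_map; apply: size_horner_leq.
have : (0 < size A)%N by apply: leq_ltn_trans ltA.
by case: (size A) => // a _; rewrite mulnDl leq_add ?leq_pmulr // mulnC leq_mul.
Qed.

(** * Functions of linear growth are polynomial *)

(** Newton interpolation: clearing denominators by M keeps P over the ring. *)
Lemma interpolation (R : idomainType) (f : R -> R) (s : seq R) :
    uniq s ->
  exists M (P : {poly R}),
    [/\ M != 0, (size P <= size s)%N & {in s, forall a, P.[a] = M * f a}].
Proof.
elim: s => [_|a s IHs /= /andP[a_s /IHs[M [P [M0 sP interpP]]]]].
  by exists 1, 0; rewrite oner_neq0 size_poly0.
pose u := \prod_(b <- s) ('X - b%:P).
have su : size u = (size s).+1 by rewrite size_prod_XsubC.
have ua0 : u.[a] != 0 by rewrite -/(root u a) root_prod_XsubC.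
exists (u.[a] * M), (u.[a] *: P + (M * f a - P.[a]) *: u); split.
- by rewrite mulf_neq0.
- rewrite (leq_trans (size_polyD _ _)) // geq_max.
  rewrite (leq_trans (size_scale_leq _ _)) ?(leq_trans sP) //.
  by rewrite (leq_trans (size_scale_leq _ _)) ?su.
move=> b; rewrite inE => /predU1P[->|b_s]; rewrite !hornerE.
  by rewrite [X in _ + X]mulrC -mulrDr addrC subrK mulrA.
have /eqP-> : root u b by rewrite root_prod_XsubC.
by rewrite mulr0 addr0 interpP // mulrA.
Qed.

(** The differences A - a, for a in s, are coprime up to the divisors of the
    fixed polynomials b - a; Delta is a product of these and so does not depend
    on A. *)
Lemma prod_dvd_mul (F : fieldType) (s : seq {poly F}) :
    uniq s ->
  exists2 Delta : {poly F}, Delta != 0 &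
    forall A G, {in s, forall a, A - a %| G} ->
      \prod_(a <- s) (A - a) %| Delta * G.
Proof.
elim: s => [_|b s IHs /= /andP[b_s /IHs[Delta Delta0 dvdDelta]]].
  by exists 1; rewrite ?oner_neq0 // => A G _; rewrite big_nil dvd1p.
pose u := \prod_(a <- s) ('X - a%:P).
have uE A : u.[A] = \prod_(a <- s) (A - a).
  by rewrite horner_prod; apply: eq_bigr => a _; rewrite hornerXsubC.
(* u.[A] is congruent to u.[b] modulo A - b, so A - b divides u.[b] * W. *)
exists (u.[b] * Delta) => [|A G dvdG].
  by rewrite mulf_neq0 // -/(root u b) root_prod_XsubC.
have /dvdpP[W defW] := dvdDelta A G (fun a a_s => dvdG a (mem_behead (s := b :: s) a_s)).
rewrite big_cons -mulrA defW mulrA dvdp_mul //.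
have [k uAb] := dvd_horner_sub u A b.
have -> : u.[b] * W = u.[A] * W - (A - b) * k * W by rewrite -uAb mulrBl subKr.
apply: dvdp_sub; last by rewrite -mulrA dvdp_mulr // dvdp_mulr.
by rewrite uE mulrC -defW dvdp_mull // dvdG ?mem_head.
Qed.

Section SeparableZeros.
Variable F : finFieldType.
Local Notation q := #|F|.

(** All the nodes have derivative 1, which makes every 'X^(q ^ m) - node i
    separable. *)
Definition node (i : nat) : {poly F} := 'X + 'X^(q * i).

Lemma size_deriv_node i : size (node i)^`() = 1%N.
Proof.
rewrite derivD derivX derivXn -mulr_natr natrM -!polyC_natr card_natr_eq0.
by rewrite mul0r mulr0 addr0 size_poly1.
Qed.

Lemma uniq_node k : uniq (map node (iota 0 k)).
Proof.
rewrite map_inj_uniq ?iota_uniq // => i j /addrI/(congr1 (fun p : {poly F} => size p)).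
rewrite !size_polyXn => -[/eqP]; rewrite eqn_pmul2l => [/eqP //|].
exact: ltnW (finNzRing_gt1 F).
Qed.

Lemma card_exp_gt (m : nat) : (m < q ^ m)%N.
Proof. exact/ltn_expl/finNzRing_gt1. Qed.

Lemma size_Xn_sub (B : {poly F}) N :
  (size B <= N)%N -> size ('X^N - B) = N.+1.
Proof. by move=> sB; rewrite size_polyDl ?size_polyXn // size_polyN. Qed.

(** The C + 1 differences 'X^N - node i all divide g 'X^N, where N = q ^ m; up to
    the fixed factor Delta so does their product, of degree (C + 1) * N, whereas
    g 'X^N has degree at most C * N + c0. *)
Lemma zero_on_Xn (g : {poly F} -> {poly F}) C c0 :
    congr_mod_primes g ->
    (exists D, forall A : {poly F}, D < size A -> size (g A) <= C * (size A).-1 + c0)%N ->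
    (forall i, (i <= C)%N -> g (node i) = 0) ->
  exists m0, forall m, (m0 <= m)%N -> g 'X^(q ^ m) = 0.
Proof.
move=> cong_g [D sg] g_node.
have [Delta Delta0 dvdDelta] := prod_dvd_mul (uniq_node C.+1).
exists (D + q * C + 2 + c0 + size Delta)%N => m le_m; set N := (q ^ m)%N.
have lt_N : (D + q * C + 2 + c0 + size Delta < N)%N.
  exact: leq_ltn_trans le_m (card_exp_gt m).
have m_gt0 : (0 < m)%N by apply: leq_trans le_m; lia.
have dvd_g : {in map node (iota 0 C.+1), forall a, 'X^N - a %| g 'X^N}.
  move=> a /mapP[i]; rewrite mem_iota add0n ltnS => /andP[_ leiC] ->.
  rewrite -[g _]subr0 -(g_node i leiC); apply: congr_mod_separable => //.
  by apply: separable_Xn_sub; rewrite ?size_deriv_node.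
have s_node i : (i <= C)%N -> (size (node i) <= N)%N.
  move=> leiC; apply: leq_trans (size_polyD _ _) _.
  rewrite geq_max size_polyX size_polyXn.
  have : (q * i <= q * C)%N by rewrite leq_mul.
  by lia.
have s_prod : size (\prod_(a <- map node (iota 0 C.+1)) ('X^N - a)) = (C.+1 * N).+1.
  rewrite size_prod_seq => [|a /mapP[i]]; last first.
    rewrite mem_iota add0n ltnS => /andP[_ leiC] ->.
    by rewrite -size_poly_gt0 size_Xn_sub ?s_node.
  rewrite size_map size_iota (eq_big_seq (fun=> N.+1)) => [|a /mapP[i]]; last first.
    by rewrite mem_iota add0n ltnS => /andP[_ leiC] ->; rewrite size_Xn_sub ?s_node.
  rewrite big_const_seq count_predT size_map size_iota iter_addn_0.
  lia.
have := dvdDelta _ _ dvd_g; apply: contraTeq => g0.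
rewrite gtNdvdp ?mulf_neq0 // s_prod size_mul //.
have := sg 'X^N; rewrite size_polyXn /= => /(_ _)/(leq_add (leqnn (size Delta)))-h.
have {h} : (size Delta + size (g 'X^N) <= size Delta + (C * N + c0))%N by apply: h; lia.
rewrite mulSn; move: (C * N)%N (size (g _)) (size Delta) lt_N => u v w; lia.
Qed.

(** If the derivative of B is a nonzero constant, 'X^(q ^ k) - B is separable and
    divides g B for all large k, so g B = 0. An arbitrary B is congruent modulo
    'X^(q ^ m) - 'X to a polynomial Z of derivative 1, to which this applies. *)
Lemma zero_of_zero_on_Xn (g : {poly F} -> {poly F}) m0 :
    congr_mod_primes g -> (forall m, (m0 <= m)%N -> g 'X^(q ^ m) = 0) ->
  forall B, g B = 0.
Proof.
move=> cong_g gX0.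
have zero_of_dvd G : (forall m, (m0 < m)%N -> exists2 S : {poly F},
    (m <= size S)%N & S %| G) -> G = 0.
  move=> dvdG; have [S sS S_G] := dvdG (m0 + size G).+1 (leq_addr _ _).
  apply: contraTeq S_G => G0; rewrite gtNdvdp //.
  by rewrite (leq_trans _ sS) // ltnS leq_addl.
have gZ B : size B^`() = 1%N -> g B = 0.
  move=> sB; apply: zero_of_dvd => m lt_m; pose k := (m + size B)%N.
  exists ('X^(q ^ k) - B).
    have lt_k : (m + size B < q ^ k)%N := card_exp_gt k.
    rewrite size_Xn_sub.
      by rewrite ltnW // ltnS (leq_trans _ (ltnW lt_k)) ?leq_addr.
    by rewrite (leq_trans _ (ltnW lt_k)) ?leq_addl.
  rewrite -dvdpNr -[- g B]sub0r -(gX0 k); last first.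
    by rewrite (leq_trans (ltnW lt_m)) ?leq_addr.
  apply: congr_mod_separable => //; apply: separable_Xn_sub => //.
  by rewrite (leq_trans _ (leq_addr _ _)) ?(leq_ltn_trans _ lt_m).
move=> B; apply: zero_of_dvd => m lt_m; exists ('X^(q ^ m) - 'X).
  have q_m_gt1 := leq_ltn_trans (leq_ltn_trans (leq0n m0) lt_m) (card_exp_gt m).
  by rewrite size_Xn_sub ?size_polyX // leqW // ltnW // card_exp_gt.
have m_gt0 : (0 < m)%N := leq_ltn_trans (leq0n m0) lt_m.
pose Z := B ^+ (q ^ m) - ('X^(q ^ m) - 'X).
have gZ0 : g Z = 0.
  by apply: gZ; rewrite !derivB derivX !deriv_exp_card // !sub0r opprK size_poly1.
rewrite -[g B]subr0 -gZ0; apply: congr_mod_separable => //.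
  by apply: separable_Xn_sub; rewrite // derivX size_poly1.
rewrite -dvdpNr opprB /Z addrAC dvdp_sub ?dvdp_exp_card_sub //.
Qed.
End SeparableZeros.

Lemma congr_mod_primes_affine (F : fieldType) (f : {poly F} -> {poly F})
    (M : {poly F}) (P : {poly {poly F}}) :
  congr_mod_primes f -> congr_mod_primes (fun A => M * f A - P.[A]).
Proof.
move=> cong_f A B p irr_p p_AB; have [k defk] := dvd_horner_sub P A B.
rewrite (_ : _ - _ = M * (f A - f B) - (A - B) * k); last by rewrite -defk; ring.
by apply: dvdp_sub; [rewrite dvdp_mull // cong_f | rewrite dvdp_mulr].
Qed.

Lemma polynomial_of_linear_growth (F : finFieldType) (f : {poly F} -> {poly F}) C D :
    congr_mod_primes f ->
    (forall A : {poly F}, (D < size A -> size (f A) <= C * size A)%N) ->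
  polynomial_map f.
Proof.
move=> cong_f sf.
have [M [P [M0 sP interpP]]] := interpolation f (uniq_node F C.+1).
pose g A := M * f A - P.[A].
have cong_g : congr_mod_primes g by apply: congr_mod_primes_affine.
have [||m0 gX0] := zero_on_Xn (C := C) (c0 := (size M + C + height P)%N) cong_g.
- exists D => A ltA; rewrite (leq_trans (size_polyD _ _)) // size_polyN geq_max.
  apply/andP; split.
    apply: leq_trans (size_polyMleq _ _) _; have := sf A ltA.
    have : (0 < size A)%N by apply: leq_ltn_trans ltA.
    case: (size A) => //= a _; rewrite mulnS.
    move: (size (f A)) (size M) (C * a)%N => u v w; lia.
  rewrite size_map size_iota in sP.
  apply: leq_trans (size_horner_leq A (size_coef_height P) sP) _.
  by rewrite mulnC addnC leq_add2l leq_addl.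
- move=> i leiC; rewrite /g interpP ?subrr // map_f // mem_iota add0n.
  by rewrite ltnS.
have g0 := zero_of_zero_on_Xn cong_g gX0.
exists ((tofrac M)^-1 *: map_poly (@tofrac _) P) => A.
have /eqP := g0 A; rewrite subr_eq0 hornerZ horner_map => /eqP <-.
by rewrite rmorphM mulKf // tofrac_eq0.
Qed.

(** * From the growth hypothesis to the theorem *)

(** The finitely many A of degree less than N have bounded f A, and d / q ^ d
    does not increase with d >= 1; so for n large the bound available in degree m >= n also holds,
    with m = n, for every A of degree less than n. *)
Lemma growth_uniform (F : finFieldType) (f : {poly F} -> {poly F}) N :
    (forall A : {poly F}, let d := (size A).-1 in
      N <= d -> 0 < d -> 27 * #|F| * d * (size (f A)).-1 < #|F| ^ d)%N ->
  exists2 n, (0 < n)%N & forall A : {poly F}, let m := maxn n (size A).-1 in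
    (27 * #|F| * m * (size (f A)).-1 < #|F| ^ m)%N.
Proof.
set q := #|F| => small_f; have q_gt1 : (1 < q)%N := finNzRing_gt1 F.
pose C := (\max_(A : {poly_N.+1 F}) (size (f A)).-1)%N.
pose K := (27 * q * C)%N; pose k := (N + K).+1.
exists (2 * k)%N => // A; move: (small_f A) => /=.
set d := (size A).-1; set s := (size (f A)).-1 => small_fA.
have [le_d|lt_d] := leqP (2 * k) d.
  by apply: small_fA; rewrite (leq_trans _ le_d) /k //; lia.
have [d_big|d_small] := boolP ((N <= d) && (0 < d))%N.
  case/andP: d_big => leNd d_gt0; have := small_fA leNd d_gt0.
  have := leq_mul_exp q_gt1 d_gt0 (ltnW lt_d).
  move: (q ^ _)%N (q ^ d)%N => u v le_uv lt_v.
  rewrite -(ltn_pmul2l d_gt0) (leq_trans _ le_uv) //.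
  have : (2 * k * (27 * q * d * s) < 2 * k * v)%N by rewrite ltn_pmul2l.
  lia.
have leC : (s <= C)%N.
  have sA : (size A <= N.+1)%N.
    by move: d_small; rewrite /d; case: (size A) => [|[|a]] //=; lia.
  have := leq_bigmax (F := fun A : {poly_N.+1 F} => (size (f A)).-1) (npolyp N.+1 A).
  by rewrite npolypK.
have : (27 * q * (2 * k) * s <= 2 * k * K)%N.
  have : (2 * k * (27 * q * s) <= 2 * k * (27 * q * C))%N by rewrite !leq_mul.
  rewrite /K; lia.
move=> /leq_ltn_trans-> //.
have : (2 ^ (2 * k) <= q ^ (2 * k))%N by rewrite leq_exp2r.
apply: leq_trans; rewrite mul2n -addnn expnD addnn -mul2n mulnAC.
have lt_k : (k < 2 ^ k)%N by apply: ltn_expl.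
have le_2K : (2 * K <= 2 ^ k)%N.
  rewrite /k expnS leq_mul // (leq_trans (ltnW (ltn_expl K (ltnSn 1)))) //.
  by rewrite leq_exp2l // leq_addl.
apply: leq_ltn_trans (leq_mul le_2K (leqnn k)) _; rewrite ltn_pmul2l ?expn_gt0 //.
Qed.

Theorem theorem1p4 (F : finFieldType) (f : {poly F} -> {poly F})
    (f_congr : forall A B P : {poly F},
      irreducible_poly P -> P %| f (A + B * P) - f A)
    (f_deg : exists N : nat, forall (A : {poly F}) (d : nat),
      deg A = (d%:R)%:E -> (N <= d)%N ->
      (deg (f A) < ((#|F|%:R ^+ d) / (27%:R * #|F|%:R * d%:R))%:E)%E) :
  polynomial_map f.
Proof.
have cong_f : congr_mod_primes f.
  move=> A B P irrP /dvdpP[k defA]; rewrite -[A](subrK B) defA [k * P + B]addrC.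
  exact: f_congr.
have [N small_f] := f_deg.
have [|n n_gt0 growth] := @growth_uniform F f N.
  move=> A /= leN d_gt0.
  have A0 : A != 0 by rewrite -size_poly_gt0 (leq_trans d_gt0) ?leq_pred.
  have := small_f A (size A).-1; rewrite {1}/deg (negPf A0) => /(_ erefl leN).
  rewrite /deg; case: eqP => [->|_].
    by rewrite size_poly0 muln0 expn_gt0 (ltnW (finNzRing_gt1 F)).
  rewrite lte_fin ltr_pdivlMr; last first.
    by rewrite -!natrM ltr0n !muln_gt0 d_gt0 (ltnW (finNzRing_gt1 F)).
  by rewrite -natrX -!natrM ltr_nat mulnC.
have [Q Q0 Qf] := algebraic_of_growth cong_f n_gt0 growth.
have [C [D sf]] := linear_growth Q0 Qf.
exact: polynomial_of_linear_growth cong_f sf.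
Qed.
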